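(* Let $2\leq s<\infty$. The variation operator $\mathcal{V}$ maps $H^1(\mathbb{R})$ to $L^1(\mathbb{R})$; that is, there is a constant $C>0$ such that $\|\mathcal{V}f\|_{L^1(\mathbb{R})}\leq C\|f\|_{H^1(\mathbb{R})}$ for all $f\in H^1(\mathbb{R})$.
   Context: For a locally integrable function $f$ on $\mathbb{R}$ and $n\in\mathbb{Z}$ put $A_nf(x)=\frac{1}{2^n}\int_x^{x+2^n}f(y)\,dy$. For fixed $2\leq s<\infty$ the variation operator is $\mathcal{V}f(x)=\left(\sum_{n=-\infty}^{\infty}|A_nf(x)-A_{n-1}f(x)|^s\right)^{1/s}$. $H^1(\mathbb{R})$ is the usual (real) Hardy space on $\mathbb{R}$. *)

(* Defs.v *)
From HB Require Import structures.
From mathcomp Require Import all_boot all_order all_algebra.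
From mathcomp Require Import all_classical all_reals all_analysis.

Set Implicit Arguments.
Unset Strict Implicit.
Unset Printing Implicit Defensive.

Import Order.TTheory GRing.Theory Num.Theory.
Import numFieldNormedType.Exports.

Local Open Scope classical_set_scope.
Local Open Scope ring_scope.

(* An L^infinity atom: supported in a compact interval I, of mean zero, and
   essentially bounded by 1/|I|. *)
Definition atom (R : realType) (a : R -> R) : Prop :=
  exists u v : R,
    [/\ u < v,
        measurable_fun [set: R] a,
        (forall x, x \notin `[u, v] -> a x = 0),
        ('N[lebesgue_measure]_+oo[EFin \o a] <= ((v - u)^-1)%:E)%E
      & \int[lebesgue_measure]_(x in `[u, v]) a x = 0].

(* f = sum_j c_j a_j, with atoms a_j, summable coefficients c_j, and
   convergence in L^1. Zero coefficients account for finite sums. *)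
Definition atomic_decomposition (R : realType) (f : R -> R) (c : nat -> R)
    (a : nat -> R -> R) : Prop :=
  [/\ (forall j, atom (a j)),
      (\sum_(0 <= j <oo) `|c j|%:E < +oo)%E
    & ('N[lebesgue_measure]_1[
          (fun x => (f x - \sum_(j < n) c j * a j x)%R%:E)])%E
        @[n --> \oo] --> 0%E].

(* The real Hardy space H^1(R), in its atomic definition. Its elements are
   represented by Borel functions; membership and norm are invariant under
   equality almost everywhere of such functions. *)
Definition hardy1 (R : realType) : set (R -> R) :=
  [set f | lebesgue_measure.-integrable [set: R] (EFin \o f) /\
           exists c a, atomic_decomposition f c a].

Definition hardy1_norm (R : realType) (f : R -> R) : \bar R :=
  ereal_inf [set t | exists c a, atomic_decomposition f c a /\
                     t = (\sum_(0 <= j <oo) `|c j|%:E)%E].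

(* The power [2 ^ n] has an integer exponent. *)
Definition forward_average (R : realType) (n : int) (f : R -> R) (x : R) : R :=
  (2 ^ n)^-1 * \int[lebesgue_measure]_(y in `[x, x + 2 ^ n]) f y.

(* The sum over all integers may diverge, so the values are extended reals. *)
Definition variation_operator (R : realType) (s : R) (f : R -> R) (x : R) : \bar R :=
  ((\esum_(n in [set: int])
      (`|forward_average n f x - forward_average (n - 1) f x| `^ s)%:E) `^ s^-1)%E.

(* Main.v *)
Require Import Defs.
From mathcomp Require Import all_boot all_order all_algebra.
From mathcomp Require Import all_classical all_reals all_analysis.
From mathcomp Require Import measurable_realfun ess_sup_inf lra.
Import Order.TTheory GRing.Theory Num.Theory.
Import numFieldNormedType.Exports.

Set Implicit Arguments.
Unset Strict Implicit.
Unset Printing Implicit Defensive.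

Local Open Scope classical_set_scope.
Local Open Scope ring_scope.

(* For an atom [a] supported in [u, v], let [F] be its primitive and
   [L = v - u], so that [A_n a (x) = 2 ^- n * (F (x + 2 ^ n) - F x)], where [F]
   is supported in [u, v], bounded by 1, and (1 / L)-Lipschitz.

   Since [A_n a (x)] is the mean of [A_(n-1) a] at [x] and [x + 2 ^ (n - 1)], the
   parallelogram law and translation invariance give the exact identity
   [|A_n a - A_(n-1) a|_2 ^ 2 = |A_(n-1) a|_2 ^ 2 - |A_n a|_2 ^ 2], which
   telescopes and bounds the square function of [a] in L^2, hence in L^1 near
   [u, v]. To the right of [v] everything vanishes; to the left of [u - L] only
   the scales [2 ^ n > L] contribute, the [n]-th one at most [L / 2 ^ n] in L^1.

   For [f = sum_j c_j a_j], the averages of the partial sums converge everywhere,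
   so Minkowski's inequality in l^s and lower semicontinuity of the l^s norm give
   the pointwise bound [V f <= sum_j |c_j| V a_j]. *)

(** * Enumeration of the integers *)

(** The order is 0, -1, 1, -2, 2, ..., so that the first [M.*2] values are exactly the integers from
    [- M] to [M - 1]. These symmetric blocks are what makes a sum over all scales telescope. *)
Definition int_of_nat (k : nat) : int := if odd k then Negz k./2 else Posz k./2.

Lemma int_of_nat_bij : set_bij [set: nat] [set: int] int_of_nat.
Proof.
split => //.
- move=> i j _ _; rewrite /int_of_nat.
  have := odd_double_half j; have := odd_double_half i.
  by case: (odd i); case: (odd j) => // iE jE [ij]; rewrite -iE -jE ij.
- move=> [n|n] _; [exists n.*2|exists n.*2.+1] => //; rewrite /int_of_nat /=.
  + by rewrite odd_double doubleK.
  + by rewrite odd_double /= uphalf_double.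
Qed.

Lemma esum_int (R : realType) (a : int -> \bar R) : (forall n, 0 <= a n)%E ->
  (\esum_(n in [set: int]) a n = \sum_(k <oo) a (int_of_nat k))%E.
Proof.
move=> a0; rewrite (reindex_esum _ _ _ _ int_of_nat_bij) -nneseries_esumT//.
Qed.

(** * The l^s norms of sequences, as Lebesgue norms for the counting measure *)

Section little_lp.
Context {R : realType}.
Local Open Scope ereal_scope.
Local Notation "'N_ p [ f ]" := (Lnorm (@counting nat R) p%:E f).
Implicit Types (d : nat -> R) (p s : R).

Lemma LnormZ_counting s d (c : R) : (0 < s)%R ->
  'N_s[EFin \o (fun k => c * d k)%R] = `|c|%:E * 'N_s[EFin \o d].
Proof.
move=> s0; rewrite !Lnorm_counting//.
under eq_eseriesr do rewrite /= normrM powRM// EFinM.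
rewrite nneseriesZl//.
have S0 : 0 <= \sum_(k <oo) (`|d k| `^ s)%:E.
  by apply: nneseries_ge0 => k _ _; rewrite lee_fin powR_ge0.
rewrite poweRM ?lee_fin ?powR_ge0//.
by rewrite poweR_EFin -powRrM divff ?gt_eqF// powRr1.
Qed.

Lemma Lnorm_counting_sum s (d : nat -> nat -> R) (c : nat -> R) N : (1 <= s)%R ->
  'N_s[EFin \o (fun k => \sum_(j < N) c j * d j k)%R] <=
  \sum_(j < N) `|c j|%:E * 'N_s[EFin \o d j].
Proof.
move=> s1; have s0 : (0 < s)%R by apply: lt_le_trans s1.
elim: N => [|N IH].
  rewrite big_ord0 (_ : _ \o _ = cst 0) ?Lnorm0 ?eqe ?gt_eqF//.
  by apply/funext => k /=; rewrite big_ord0.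
rewrite big_ord_recr /= -LnormZ_counting//.
apply: le_trans; last by apply: leeD IH (lexx _).
apply: le_trans; last exact: minkowski_EFin.
rewrite le_eqVlt; apply/orP; left; apply/eqP; apply: eq_Lnorm => k /=.
by rewrite big_ord_recr.
Qed.

(** Partial sums of nonnegative terms increase to the full sum, and taking s-th powers and roots is
    monotone. This reduces norm bounds to finite sums, also for infinite [W]. *)
Lemma Lnorm_counting_le s d (W : \bar R) : (0 < s)%R -> 0 <= W ->
  (forall K, \sum_(k < K) (`|d k| `^ s)%:E <= W `^ s) <-> 'N_s[EFin \o d] <= W.
Proof.
move=> s0 W0; rewrite Lnorm_counting//.
have t0 k : 0 <= (`|d k| `^ s)%:E by rewrite lee_fin powR_ge0.
set S := \sum_(k <oo) _.
have S0 : 0 <= S by apply: nneseries_ge0 => k _ _; exact: t0.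
have sn : s != 0%R by rewrite gt_eqF.
split => [H|H K].
  have SW : S <= W `^ s.
    apply: lime_le; first by apply: is_cvg_nneseries => k _ _; exact: t0.
    by apply: nearW => K; rewrite /= big_mkord.
  rewrite -[leRHS](poweRe1 W0) -(divff sn) poweRrM.
  apply: gt0_ler_poweR => //; rewrite ?invr_ge0 ?in_itv /= ?leey ?andbT ?poweR_ge0//.
  exact: ltW.
apply: (@le_trans _ _ S).
  rewrite -(big_mkord xpredT (fun k => (`|d k| `^ s)%:E)).
  by apply: nneseries_lim_ge => k _ _; exact: t0.
rewrite -[leLHS](poweRe1 S0) -(mulVf sn) poweRrM.
apply: gt0_ler_poweR => //; rewrite ?in_itv /= ?leey ?andbT ?poweR_ge0//.
exact: ltW.
Qed.

(** With [W] the l^p norm, every entry satisfies [|d k| <= W], hence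
    [|d k| ^ s <= W ^ (s - p) * |d k| ^ p]; summing over [k] gives at most [W ^ s]. An infinite [W]
    is trivial. *)
Lemma le_Lnorm_counting p s d : (0 < p)%R -> (p <= s)%R ->
  'N_s[EFin \o d] <= 'N_p[EFin \o d].
Proof.
move=> p0 ps; have s0 : (0 < s)%R by apply: lt_le_trans ps.
have : 0 <= 'N_p[EFin \o d] by exact: Lnorm_ge0.
have := (@Lnorm_counting_le p d 'N_p[EFin \o d] p0 (Lnorm_ge0 _ _ _)).2 (lexx _).
move: ('N_p[EFin \o d]) => [W||//] H W0; last by rewrite leey.
apply/Lnorm_counting_le => // K.
move: W0; rewrite lee_fin => W0.
have dW k : (k < K)%N -> (`|d k| <= W)%R.
  move=> kK; have := H K.
  rewrite (bigD1 (Ordinal kK))//= => H'.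
  have : (`|d k| `^ p)%:E <= W%:E `^ p.
    apply: le_trans H'; rewrite leeDl//; apply: sume_ge0 => i _.
    by rewrite lee_fin powR_ge0.
  rewrite poweR_EFin lee_fin.
  have := @ge0_ler_powR _ p^-1 _ (`|d k| `^ p)%R (W `^ p)%R.
  rewrite invr_ge0 !nnegrE !powR_ge0 ltW// => /(_ isT isT isT) h /h.
  by rewrite -!powRrM divff ?gt_eqF// !powRr1.
have : \sum_(k < K) (`|d k| `^ s)%:E <= \sum_(k < K) (W `^ (s - p))%:E * (`|d k| `^ p)%:E.
  apply: lee_sum => k _; rewrite -EFinM lee_fin.
  have -> : s = (s - p + p)%R by rewrite subrK.
  have [->|dk0] := eqVneq (d k) 0%R.
    by rewrite normr0 subrK !powR0 ?gt_eqF// mulr0.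
  rewrite powRD; last by rewrite normr_eq0 dk0 implybT.
  rewrite addrK ler_wpM2r ?powR_ge0// ge0_ler_powR ?subr_ge0 ?nnegrE//.
  exact: dW.
move=> /le_trans; apply.
rewrite -ge0_sume_distrr; last by move=> i _; rewrite lee_fin powR_ge0.
apply: le_trans (lee_wpmul2l _ (H K)) _; first by rewrite lee_fin powR_ge0.
rewrite !poweR_EFin -EFinM lee_fin.
have [->|Wn0] := eqVneq W 0%R; first by rewrite (@powR0 _ p) ?gt_eqF// mulr0 powR_ge0.
by rewrite -powRD ?subrK// Wn0 implybT.
Qed.

(* Minkowski on the first [K] coordinates, where convergence is uniform. *)
Lemma Lnorm_counting_lsc s (dN : nat -> nat -> R) d (W : \bar R) :
  (1 <= s)%R -> 0 <= W ->
  (forall k, dN N k @[N --> \oo] --> d k) ->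
  (forall N, 'N_s[EFin \o dN N] <= W) -> 'N_s[EFin \o d] <= W.
Proof.
move=> s1 W0 dNd dNW; have s0 : (0 < s)%R by apply: lt_le_trans s1.
apply/Lnorm_counting_le => // K.
pose tr (g : nat -> R) k := if (k < K)%N then g k else 0%R.
(* Only the first [K] coordinates enter the partial sum, and there [tr d] agrees with [d]. *)
suff : 'N_s[EFin \o tr d] <= W.
  move/(Lnorm_counting_le _ s0 W0) => /(_ K); apply: le_trans.
  by apply: lee_sum => k _; rewrite /tr ltn_ord.
have trW N : 'N_s[EFin \o tr (dN N)] <= W.
  apply/Lnorm_counting_le => // K'.
  apply: le_trans ((Lnorm_counting_le _ s0 W0).2 (dNW N) K').
  apply: lee_sum => k _; rewrite lee_fin /tr; case: ifP => // _.
  by rewrite normr0 powR0 ?powR_ge0// gt_eqF.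
have sum_cvg : (\sum_(k < K) `|d k - dN N k|)%R @[N --> \oo] --> (0 : R)%R.
  elim: K {tr trW} => [|K IH].
    rewrite [X in X @ _](_ : _ = cst 0%R); first exact: cvg_cst.
    by apply/funext => N; rewrite big_ord0.
  have dK : `|d K - dN N K|%R @[N --> \oo] --> (0 : R)%R.
    rewrite -(@normr0 _ R) -(subrr (d K)).
    apply: cvg_norm.
    exact: (cvgB (cvg_cst (d K)) (dNd K)).
  have -> : (fun N => \sum_(k < K.+1) `|d k - dN N k|)%R =
      ((fun N => \sum_(k < K) `|d k - dN N k|) \+ (fun N => `|d K - dN N K|))%R.
    by apply/funext => N; rewrite big_ord_recr.
  have := cvgD IH dK; rewrite addr0.
  move=> h; exact: h.
apply/lee_addgt0Pr => e e0.
have [N _ /(_ N (leqnn N)) /= sumN] := cvgr0_norm_le _ sum_cvg _ e0.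
have -> : EFin \o tr d = EFin \o (tr (dN N) \+ tr (d \- dN N))%R.
  apply/funext => k /=; congr EFin; rewrite /tr /=.
  by case: ifP => _; rewrite ?addr0// addrC subrK.
(* The truncated error is measured in l^1, which dominates l^s; [N] was chosen to make its l^1 norm
   at most [e]. *)
apply: le_trans (minkowski_EFin _ _ _ _) _ => //.
apply: leeD => //.
apply: (le_trans (le_Lnorm_counting _ _ s1)) => //.
apply/Lnorm_counting_le => //; first by rewrite lee_fin ltW.
move=> K'; rewrite poweR_EFin powRr1 ?(ltW e0)//.
have t0 k : 0 <= (`|tr (d \- dN N)%R k| `^ 1)%:E by rewrite lee_fin powR_ge0.
rewrite -(big_mkord xpredT (fun k => (`|tr (d \- dN N)%R k| `^ 1)%:E)).
apply: (@le_trans _ _ (\sum_(0 <= k < K + K') (`|tr (d \- dN N)%R k| `^ 1)%:E)).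
  by apply: lee_sum_nneg_natr => //; rewrite leq_addl.
rewrite (@big_cat_nat _ _ _ K)//= ?leq_addr//.
rewrite [X in _ + X]big_nat [X in _ + X]big1 ?adde0; last first.
  by move=> k /andP[Kk _]; rewrite /tr ltnNge Kk normr0 powR0.
rewrite big_mkord sumEFin lee_fin; apply: le_trans (le_trans (ler_norm _) sumN).
by apply: ler_sum => k _; rewrite /tr ltn_ord powRr1.
Qed.

Lemma measurable_Lnorm_counting (disp : measure_display)
    (T : measurableType disp) s (f : nat -> T -> R) :
  (0 < s)%R -> (forall k, measurable_fun [set: T] (f k)) ->
  measurable_fun [set: T] (fun x => 'N_s[EFin \o (fun k => f k x)]).
Proof.
move=> s0 md; under eq_fun do rewrite Lnorm_counting//.
apply: (measurableT_comp (measurable_poweR _)).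
apply: ge0_emeasurable_sum => [k x _ _|k _]; first exact: poweR_ge0.
apply: (measurableT_comp (measurable_poweR _)).
by apply/measurable_EFinP; exact: measurableT_comp.
Qed.

End little_lp.

(** * Translation invariance of Lebesgue measure *)

Section translation.
Context {R : realType}.
Local Notation mu := (@lebesgue_measure R).

(** A translate of a half-open interval has the same length, and Lebesgue measure is the only
    measure with these values on half-open intervals. *)
Lemma lebesgue_measure_translation (c : R) (A : set R) : measurable A ->
  pushforward mu ((fun x => x + c) : measurableTypeR R -> measurableTypeR R) A = mu A.
Proof.
move=> mA; apply/esym/lebesgue_measure_unique => //=.
  exact: measurable_funD.
move=> mf _ [[a b]] _ <-.
rewrite /pushforward /=.
have -> : (fun x => x + c) @^-1` `]a, b]%classic = `]a - c, b - c]%classic.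
  by apply/seteqP; split => x /=; rewrite !in_itv/= ltrBlDr lerBrDr.
rewrite !lebesgue_measure_itv/= !lte_fin ltrD2r -!EFinB.
by case: ifP => // _; congr (_%:E); lra.
Qed.

Lemma ge0_integral_translation (c : R) (f : R -> \bar R) :
  measurable_fun [set: R] f -> (forall x, 0 <= f x)%E ->
  (\int[mu]_x f (x + c)%R = \int[mu]_x f x)%E.
Proof.
move=> mf f0.
have mc : @measurable_fun _ _ (measurableTypeR R) (measurableTypeR R) setT
    (fun x : R => x + c).
  exact: measurable_funD.
have := ge0_integral_pushforward mc mu measurableT mf (fun y _ => f0 y).
rewrite preimage_setT /comp => <-.
by apply: eq_measure_integral => A mA _; exact: lebesgue_measure_translation.
Qed.

End translation.

(** * Primitives of integrable functions *)

Section primitive.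
Context {R : realType}.
Local Notation mu := (@lebesgue_measure R).
Implicit Types (f g : R -> R).

Definition primitive f (x : R) : R := \int[mu]_(t in `]-oo, x]) f t.

Lemma integrable_sub f (A : set R) : measurable A ->
  mu.-integrable [set: R] (EFin \o f) -> mu.-integrable A (EFin \o f).
Proof. by move=> mA; exact: integrableS. Qed.

Lemma primitiveB f x y : mu.-integrable [set: R] (EFin \o f) -> x <= y ->
  primitive f y - primitive f x = \int[mu]_(t in `[x, y]) f t.
Proof.
move=> intf xy; rewrite /primitive Rintegral_itvB//.
- by rewrite Rintegral_itv_obnd_cbnd//; exact: integrable_sub.
- exact: integrable_sub.
Qed.

(** The primitive of a nonnegative function is nondecreasing, hence measurable; the general case is
    the difference of the primitives of the positive and negative parts. *)
Lemma measurable_primitive f : mu.-integrable [set: R] (EFin \o f) ->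
  measurable_fun [set: R] (primitive f).
Proof.
move=> intf.
have ndP g : (forall x, 0 <= g x) -> mu.-integrable [set: R] (EFin \o g) ->
    measurable_fun [set: R] (primitive g).
  move=> g0 intg; apply: nondecreasing_measurable => // x y xy.
  by rewrite -subr_ge0 primitiveB//; apply: Rintegral_ge0.
have ip := integrable_funrpos measurableT intf.
have im := integrable_funrneg measurableT intf.
rewrite (_ : primitive f = primitive f^\+ \- primitive f^\-).
  by apply: measurable_funB; apply: ndP => // x; rewrite ?funrpos_ge0 ?funrneg_ge0.
apply/funext => x; rewrite /primitive /= -RintegralB//; last 2 first.
- exact: integrable_sub.
- exact: integrable_sub.
by apply: eq_Rintegral => t _; rewrite -{1}(funrposBneg f).
Qed.

Lemma forward_averageE n f x : mu.-integrable [set: R] (EFin \o f) ->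
  forward_average n f x = (2 ^ n)^-1 * (primitive f (x + 2 ^ n) - primitive f x).
Proof.
by move=> intf; rewrite primitiveB// lerDl exprz_ge0.
Qed.

(** Since the bound does not depend on [x], convergence in L^1 makes the primitives converge at
    every point, not merely almost everywhere. *)
Lemma primitive_dist f g x :
  mu.-integrable [set: R] (EFin \o f) -> mu.-integrable [set: R] (EFin \o g) ->
  (`|primitive f x - primitive g x|%:E <= 'N[mu]_1[EFin \o (f \- g)%R])%E.
Proof.
move=> intf intg; rewrite /primitive -RintegralB//; last 2 first.
- exact: integrable_sub.
- exact: integrable_sub.
have intfg : mu.-integrable [set: R] (EFin \o (f \- g)).
  have := integrableB measurableT intf intg.
  by apply: eq_integrable.
rewrite EFin_normr_Rintegral//; last exact: integrable_sub.
have mfg := measurable_int _ intfg.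
apply: (le_trans (le_abse_integral _ _ _)) => //.
  exact: measurable_funTS.
rewrite Lnorm1; apply: ge0_subset_integral => //.
exact: measurableT_comp.
Qed.

Lemma primitive_sum (a : nat -> R -> R) (c : nat -> R) N x :
  (forall j, mu.-integrable [set: R] (EFin \o a j)) ->
  mu.-integrable [set: R] (EFin \o (fun y => \sum_(j < N) c j * a j y)) /\
  primitive (fun y => \sum_(j < N) c j * a j y) x =
  \sum_(j < N) c j * primitive (a j) x.
Proof.
move=> inta.
have intc j : mu.-integrable [set: R] (EFin \o (fun y => c j * a j y)).
  by have := @integrableZl _ _ _ mu _ measurableT (c j) _ (inta j); apply: eq_integrable.
elim: N => [|N [IH1 IH2]].
  split; last first.
    rewrite big_ord0 /primitive; under eq_Rintegral do rewrite big_ord0.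
    by rewrite Rintegral_cst// mul0r.
  apply: eq_integrable (integrable0 mu [set: R]) => // y _.
  by rewrite /= big_ord0.
split.
  have := integrableD measurableT IH1 (intc N).
  by apply: eq_integrable => // y _; rewrite /= big_ord_recr.
rewrite big_ord_recr/= -IH2 /primitive -RintegralZl//; last exact: integrable_sub.
rewrite -RintegralD//; last 2 first.
- exact: integrable_sub.
- exact: integrable_sub (intc N).
by apply: eq_Rintegral => t _; rewrite big_ord_recr.
Qed.

End primitive.

(** * The primitive of an atom *)

Section atoms.
Context {R : realType}.
Local Notation mu := (@lebesgue_measure R).
Implicit Types (a : R -> R).

(** The essential bound on the atom turns into the Lipschitz constant, and the mean zero condition
    makes the primitive vanish again beyond the right end of the support. *)
Lemma atom_primitive a : atom a -> exists u v : R,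
  [/\ u < v, mu.-integrable [set: R] (EFin \o a),
      (forall x, x <= u -> primitive a x = 0),
      (forall x, v <= x -> primitive a x = 0)
    & (forall x y, x <= y ->
        `|primitive a y - primitive a x| <= (v - u)^-1 * (y - x))].
Proof.
move=> [u [v [uv ma supp bnd mean]]]; exists u, v.
have ma' : measurable_fun [set: R] (EFin \o a) by exact/measurable_EFinP.
have vu0 : 0 <= (v - u)^-1 by rewrite invr_ge0 subr_ge0 ltW.
have aebnd : {ae mu, forall x, (`|(a x)%:E| <= ((v - u)^-1)%:E)%E}.
  move: bnd; rewrite unlock /=.
  (* The norm of exponent [+oo] is the essential supremum only if the whole space has positive
     measure. *)
  have -> : (mu [set: R] > 0)%E.
    by rewrite -set_itvNyy lebesgue_measure_itv/= ltry.
  by move=> /ess_supP.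
have le_bnd (A : set R) : measurable A ->
    (\int[mu]_(x in A) `|(a x)%:E| <= ((v - u)^-1)%:E * mu A)%E.
  move=> mA; apply: integral_le_bound => //.
  - exact: measurable_funTS.
  - by apply: (@filterS _ _ (ae_filter_ringOfSetsType mu)) aebnd => x /= + _.
have suppr : a = a \_ `[u, v].
  apply/funext => x; rewrite /patch; case: ifPn => //.
  by rewrite mem_setE => /supp.
have inta : mu.-integrable [set: R] (EFin \o a).
  rewrite suppr -restrict_EFin; apply/integrable_restrict => //.
  rewrite setTI; apply/integrableP; split; first exact: measurable_funTS.
  apply: le_lt_trans (le_bnd _ _) _ => //=.
  by rewrite lebesgue_measure_itv/= lte_fin uv -EFinB -EFinM ltry.
have lip x y : x <= y ->
    `|primitive a y - primitive a x| <= (v - u)^-1 * (y - x).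
  move=> xy; rewrite primitiveB// -lee_fin EFin_normr_Rintegral//; last exact: integrable_sub.
  apply: le_trans (le_abse_integral _ _ _) _ => //; first exact: measurable_funTS.
  apply: le_trans (le_bnd _ _) _ => //.
  rewrite lebesgue_measure_itv/= lte_fin -EFinB; case: ltP => _.
    by rewrite EFinM.
  by rewrite mule0 lee_fin mulr_ge0// subr_ge0.
have p0 x : x < u -> primitive a x = 0.
  move=> xu; rewrite /primitive; under eq_Rintegral => t tx.
    rewrite supp; first over.
    move: tx; rewrite inE/= !in_itv/= => tx.
    by rewrite leNgt (le_lt_trans tx xu).
  by rewrite Rintegral_cst// mul0r.
have lipu : forall x, x <= u -> primitive a x = 0.
  move=> x; rewrite le_eqVlt => /predU1P[->|]; last exact: p0.
  (* At [u] itself the atom need not vanish, so the value is reached by continuity from the left: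
     over a distance [e * (v - u)] the Lipschitz bound is exactly [e]. *)
  apply/eqP; rewrite -normr_le0; apply/ler_addgt0Pr => e e0; rewrite add0r.
  have d0 : 0 < e * (v - u) by rewrite mulr_gt0// subr_gt0.
  have := lip (u - e * (v - u)) u.
  rewrite gerBl ltW// => /(_ isT).
  rewrite (p0 (u - _)) ?gtrBl// subr0 opprB addrCA subrr addr0 mulrCA.
  by rewrite mulVf ?mulr1// subr_eq0 gt_eqF.
split => //.
(* As the primitive vanishes at [u], its value at [x] is the integral over [[u, x]], which equals
   the one over [[u, v]], that is, zero. *)
move=> x vx; have := @primitiveB _ a u x inta (le_trans (ltW uv) vx).
rewrite (lipu u)// subr0 => ->.
rewrite -mean; rewrite [LHS]Rintegral_mkcond [RHS]Rintegral_mkcond.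
apply: eq_Rintegral => t _; rewrite /patch !mem_setE !in_itv/=.
have [ut|//] := leP u t => /=.
have [tv|vt] := leP t v; first by rewrite (le_trans tv vx).
by case: ifP => // _; rewrite supp// in_itv/= ut leNgt vt.
Qed.

End atoms.

(** * Telescoping over the dyadic scales *)

Lemma pow2_pred (R : realFieldType) (n : int) : 2 ^ n = 2 * 2 ^ (n - 1) :> R.
Proof.
by rewrite -{2}(expr1z (2 : R)) -expfzDr ?pnatr_eq0// addrC subrK.
Qed.

Section telescope.
Context {R : realType}.
Local Open Scope ereal_scope.
Variables (b c : int -> \bar R) (C : \bar R).
Hypothesis b0 : forall n, 0 <= b n.
Hypothesis c0 : forall n, 0 <= c n.
Hypothesis cC : forall n, c n <= C.
Hypothesis bc : forall n, b n + c n <= c (n - 1)%R.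

(** Over the scales from [- M] to [M - 1] the sum is at most [c (- M - 1)], hence at most [C]. The
    hypothesis is written without subtraction, so [c] may take infinite values. *)
Lemma nneseries_int_telescope : \sum_(k <oo) b (int_of_nat k) <= C.
Proof.
have tele M : \sum_(0 <= k < M.*2) b (int_of_nat k) + c (M%:Z - 1)%R <= c (- M%:Z - 1)%R.
  elim: M => [|M IH]; first by rewrite big_geq// add0e.
  rewrite doubleS !big_nat_recr//= /int_of_nat /= odd_double /= uphalf_double doubleK.
  have -> : (M.+1%:Z - 1)%R = M%:Z by rewrite -addn1 PoszD addrK.
  rewrite -addeA (addeC (b (Negz M))) addeA -(addeA _ (b M)).
  have h1 := bc M%:Z; have h2 := bc (Negz M).
  apply: le_trans (leeD (leeD (lexx _) h1) (lexx _)) _.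
  apply: le_trans (leeD IH (lexx _)) _.
  rewrite addeC (_ : - M%:Z - 1 = Negz M)%R//.
  by rewrite NegzE -addn1 PoszD opprD.
apply: lime_le; first exact: is_cvg_nneseries.
apply: nearW => K /=.
apply: (@le_trans _ _ (\sum_(0 <= k < K.*2) b (int_of_nat k))).
  by apply: lee_sum_nneg_natr => //; rewrite -addnn leq_addr.
by apply: le_trans (le_trans (tele K) (cC _)); rewrite leeDl.
Qed.

End telescope.

Lemma integral_indic_itvcc (R : realType) (a b : R) : a <= b ->
  (\int[lebesgue_measure]_x (\1_(`[a, b]%classic) x)%:E = (b - a)%:E :> \bar R)%E.
Proof.
move=> ab; rewrite integral_indic// setIT.
transitivity (@lebesgue_measure R `[a, b]%classic) => //.
rewrite lebesgue_measure_itv/= lte_fin; case: ltP => // ba.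
by rewrite (_ : b - a = 0)//; lra.
Qed.

(** * Dyadic difference quotients of a compactly supported Lipschitz function *)

Section dyadic_quotient.
Context {R : realType}.
Local Notation mu := (@lebesgue_measure R).
Variables (F : R -> R) (u v : R).
Hypothesis uv : u < v.
Hypothesis mF : measurable_fun [set: R] F.
Hypothesis Fu : forall x, x <= u -> F x = 0.
Hypothesis Fv : forall x, v <= x -> F x = 0.
Hypothesis lipF : forall x y, x <= y -> `|F y - F x| <= (v - u)^-1 * (y - x).

(* For [F] a primitive of [f], this is the forward average of [f]. *)
Definition dyadic_quotient n x : R := (2 ^ n)^-1 * (F (x + 2 ^ n) - F x).
Definition dyadic_increment n x : R := dyadic_quotient n x - dyadic_quotient (n - 1) x.

Let L := v - u.
Let L0 : 0 < L. Proof. by rewrite subr_gt0. Qed.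
Let p0 (n : int) : 0 < 2 ^ n :> R. Proof. by rewrite exprz_gt0. Qed.

Lemma measurable_dyadic_quotient n : measurable_fun [set: R] (dyadic_quotient n).
Proof.
apply: measurable_funM => //; apply: measurable_funB => //.
by apply: (measurableT_comp mF); exact: measurable_funD.
Qed.

Lemma measurable_dyadic_increment n : measurable_fun [set: R] (dyadic_increment n).
Proof. by apply: measurable_funB; exact: measurable_dyadic_quotient. Qed.

(** The interval of length [2 ^ n] splits into two halves of length [2 ^ (n - 1)]. *)
Lemma dyadic_quotientD n x : dyadic_quotient n x =
  2^-1 * (dyadic_quotient (n - 1) x + dyadic_quotient (n - 1) (x + 2 ^ (n - 1))).
Proof.
rewrite /dyadic_quotient; have := pow2_pred R n; have := p0 (n - 1).
move: (2 ^ (n - 1)) => h h0 ->.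
have -> : x + 2 * h = x + h + h by lra.
rewrite invfM -mulrDr mulrA; congr (_ * _); lra.
Qed.

(** * Energies of the difference quotients in L^2 *)

Definition energy n : \bar R := (\int[mu]_x (dyadic_quotient n x ^+ 2)%:E)%E.

Lemma energy_ge0 n : (0 <= energy n)%E.
Proof. by apply: integral_ge0 => x _; rewrite lee_fin sqr_ge0. Qed.

Let msq (g : R -> R) : measurable_fun [set: R] g ->
  measurable_fun [set: R] (fun x => (g x ^+ 2)%:E).
Proof. by move=> mg; apply/measurable_EFinP; exact: measurable_funX. Qed.

Lemma energy_increment n :
  (\int[mu]_x (dyadic_increment n x ^+ 2)%:E + energy n = energy (n - 1))%E.
Proof.
pose g := dyadic_quotient (n - 1); pose h : R := 2 ^ (n - 1).
have mg : measurable_fun [set: R] g by exact: measurable_dyadic_quotient.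
have mgh : measurable_fun [set: R] (fun x => g (x + h)).
  by apply: (measurableT_comp mg); exact: measurable_funD.
rewrite /energy -ge0_integralD//; last 4 first.
- by move=> x _; rewrite lee_fin sqr_ge0.
- exact: (msq (measurable_dyadic_increment n)).
- by move=> x _; rewrite lee_fin sqr_ge0.
- exact: (msq (measurable_dyadic_quotient n)).
(* With [p = g x] and [q = g (x + h)], the increment is [(q - p) / 2] and the new quotient
   [(p + q) / 2]; their squares add up to [(p ^ 2 + q ^ 2) / 2]. *)
under eq_integral => x _.
  rewrite (_ : _ + _ = (2^-1)%:E * (g x ^+ 2)%:E +
      (2^-1)%:E * (g (x + h)%R ^+ 2)%:E)%E.
    over.
  rewrite -!EFinM -!EFinD /dyadic_increment dyadic_quotientD -/g -/h; congr (_%:E).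
  by rewrite !expr2; move: (g x) (g (x + h)) => a b; lra.
rewrite ge0_integralD//; last 4 first.
- by move=> x _; rewrite -EFinM lee_fin mulr_ge0// sqr_ge0.
- exact: measurable_funeM (msq mg).
- by move=> x _; rewrite -EFinM lee_fin mulr_ge0// sqr_ge0.
- exact: measurable_funeM (msq mgh).
rewrite !ge0_integralZl_EFin//; last 4 first.
- by move=> x _; rewrite lee_fin sqr_ge0.
- exact: (msq mgh).
- by move=> x _; rewrite lee_fin sqr_ge0.
- exact: (msq mg).
rewrite (@ge0_integral_translation _ h (fun x => (g x ^+ 2)%:E))//; last 2 first.
- exact: (msq mg).
- by move=> x; rewrite lee_fin sqr_ge0.
rewrite -ge0_muleDl ?lee_fin// -EFinD.
by rewrite (_ : 2^-1 + 2^-1 = 1 :> R) ?mul1e//; lra.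
Qed.

(** Between [u] and [v] the Lipschitz bound is applied from [u], where [F] vanishes, over a distance
    at most [v - u]. *)
Lemma lipschitz_support_le1 x : `|F x| <= 1.
Proof.
have [xu|ux] := leP x u; first by rewrite Fu// normr0.
have [vx|xv] := leP v x; first by rewrite Fv// normr0.
have := lipF (ltW ux); rewrite (Fu (lexx u)) subr0 => /le_trans; apply.
by rewrite mulrC ler_pdivrMr// mul1r lerD2r ltW.
Qed.

Lemma dyadic_quotient_outside n x : x < u - 2 ^ n \/ v < x -> dyadic_quotient n x = 0.
Proof.
have := p0 n; rewrite /dyadic_quotient; move: (2 ^ n) => h h0.
case=> hx; first by rewrite !Fu ?subrr ?mulr0//; lra.
by rewrite !Fv ?subrr ?mulr0//; lra.
Qed.

(** The quotient lives on [[u - 2 ^ n, v]], of length [L + 2 ^ n]. If [2 ^ n <= L], the Lipschitz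
    bound gives height [1 / L] and energy at most [2 / L]. Otherwise [|F| <= 1] gives height
    [2 / 2 ^ n] and energy at most [8 / 2 ^ n <= 8 / L]. *)
Lemma energy_le n : (energy n <= (8 / L)%:E)%E.
Proof.
have q0 := p0 n.
have step M : (forall x, `|dyadic_quotient n x| <= M) ->
    (energy n <= (M ^+ 2 * (L + 2 ^ n))%:E)%E.
  move=> HM.
  have M0 : 0 <= M by apply: le_trans (HM 0).
  apply: (@le_trans _ _ (\int[mu]_x
      ((M ^+ 2)%:E * (\1_(`[u - 2 ^ n, v]%classic) x)%:E))%E).
    apply: ge0_le_integral => //.
    - by move=> x _; rewrite lee_fin sqr_ge0.
    - exact: (msq (measurable_dyadic_quotient n)).
    - by apply: measurable_funeM; apply/measurable_EFinP; exact: measurable_indic.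
    move=> x _; rewrite -EFinM lee_fin indicE mem_setE in_itv/=.
    have [ux|xu] := leP (u - 2 ^ n) x; last first.
      by rewrite dyadic_quotient_outside ?mulr0 ?expr0n//; left.
    have [xv|vx] := leP x v; last first.
      by rewrite dyadic_quotient_outside ?mulr0 ?expr0n//; right.
    by rewrite mulr1 -real_normK ?num_real// ler_sqr ?nnegrE.
  rewrite ge0_integralZl_EFin ?sqr_ge0//; last first.
    by apply/measurable_EFinP; exact: measurable_indic.
  rewrite integral_indic_itvcc; last first.
    by rewrite lerBlDr (le_trans (ltW uv))// lerDl ltW.
  rewrite -EFinM lee_fin ler_wpM2l ?sqr_ge0//.
  by rewrite opprB /L addrA addrAC.
have [nL|Ln] := leP (2 ^ n) L.
  apply: le_trans (step L^-1 _) _.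
    move=> x; rewrite /dyadic_quotient normrM gtr0_norm ?invr_gt0//.
    rewrite ler_pdivrMl// [leRHS]mulrC; have := @lipF x (x + 2 ^ n).
    by rewrite lerDl ltW// => /(_ isT); rewrite (addrC x) addrK.
  rewrite lee_fin expr2 -mulrA [leRHS]mulrC ler_wpM2l ?invr_ge0 ?(ltW L0)//.
  rewrite ler_pdivrMl//; move: nL L0; move: (2 ^ n) => h; lra.
apply: le_trans (step (2 / 2 ^ n) _) _.
  move=> x; rewrite /dyadic_quotient normrM gtr0_norm ?invr_gt0// mulrC.
  rewrite ler_wpM2r ?invr_ge0 ?(ltW q0)//.
  apply: le_trans (ler_normB _ _) _.
  by have := lipschitz_support_le1 x; have := lipschitz_support_le1 (x + 2 ^ n); lra.
rewrite lee_fin.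
apply: (@le_trans _ _ ((2 / 2 ^ n) ^+ 2 * (2 * 2 ^ n))).
  by rewrite ler_wpM2l ?sqr_ge0//; move: Ln; move: (2 ^ n) => h; lra.
rewrite (_ : _ * _ = 8 / 2 ^ n); last first.
  have /mulfV : (2 ^ n : R) != 0 by exact: lt0r_neq0.
  move: (2 ^ n) (2 ^ n)^-1 => h k hk.
  have -> : (2 * k) ^+ 2 * (2 * h) = 8 * k * (h * k) by lra.
  by rewrite hk mulr1.
by rewrite ler_wpM2l// lef_pV2 ?posrE// (ltW Ln).
Qed.

(* The part of the [n]-th average at distance more than [L] to the left. *)
Let far n x : R := \1_(`]-oo, u - L[%classic) x * `|dyadic_quotient n x|.

Let far0 n x : 0 <= far n x.
Proof. by rewrite mulr_ge0// indicE. Qed.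

Let mfar n : measurable_fun [set: R] (EFin \o far n).
Proof.
apply/measurable_EFinP; apply: measurable_funM; first exact: measurable_indic.
by apply: measurableT_comp => //; exact: measurable_dyadic_quotient.
Qed.

(** The bound for the L^1 norm of [far n]. It is zero for [2 ^ n <= L], since then a window starting
    left of [u - L] does not reach the support. *)
Let b n : \bar R := (if L < 2 ^ n then L / 2 ^ n else 0)%:E.
(* [c (n - 1) - c n = b n] when [2 ^ n > L]. *)
Let c n : \bar R := (Num.min (L / 2 ^ n) 2)%:E.

Let b0 n : (0 <= b n)%E.
Proof. by rewrite lee_fin; case: ifP => // _; rewrite divr_ge0// ltW. Qed.

Let c0 n : (0 <= c n)%E.
Proof. by rewrite lee_fin le_min divr_ge0 ?ltW. Qed.

(** If [2 ^ n > L], then [L / 2 ^ (n - 1) < 2] and the cap in [c] is inactive. At smaller scales [b]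
    vanishes and monotonicity of [c] suffices; there the cap keeps [c] bounded. *)
Let bc n : (b n + c n <= c (n - 1))%E.
Proof.
rewrite -EFinD lee_fin pow2_pred; have := p0 (n - 1); move: (2 ^ (n - 1)) => h h0.
have -> : L / (2 * h) = L / h / 2 by rewrite invfM mulrCA mulrC.
case: ltP => hL.
  have : L / h < 2 by rewrite ltr_pdivrMr.
  have : 0 < L / h by rewrite divr_gt0.
  move: (L / h) => r r0 r2.
  by rewrite min_l; [rewrite min_l; lra|lra].
rewrite add0r le_min ge_min [X in _ && X]ge_min lexx orbT andbT.
by rewrite ler_pdivrMr// ler_peMr ?ler1n// divr_ge0// ltW.
Qed.

(** Left of [u] only the term [F (x + 2 ^ n)] survives. It is at most 1 in absolute value and lives
    on [[u - 2 ^ n, v - 2 ^ n]], of length [L], with the factor [1 / 2 ^ n] in front. *)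
Let integral_far n : (\int[mu]_x (far n x)%:E <= b n)%E.
Proof.
have q0 := p0 n; rewrite /b; case: ltP => hL; last first.
  rewrite integral0_eq// => x _; rewrite /far indicE mem_setE in_itv/=.
  case: ltP => [xu|]; last by rewrite mul0r.
  by rewrite dyadic_quotient_outside ?normr0 ?mulr0//; left; lra.
apply: (@le_trans _ _ (\int[mu]_x
    (((2 ^ n)^-1)%:E * (\1_(`[u - 2 ^ n, v - 2 ^ n]%classic) x)%:E))%E).
  apply: ge0_le_integral => //.
  - by move=> x _; rewrite lee_fin.
  - exact: (mfar n).
  - by apply: measurable_funeM; apply/measurable_EFinP; exact: measurable_indic.
  move=> x _; rewrite -EFinM lee_fin /far !indicE !mem_setE !in_itv/=.
  case: ltP => [xu|]; last by rewrite mul0r mulr_ge0// invr_ge0 ltW.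
  rewrite mul1r; have xu' : x <= u by move: L0; lra.
  rewrite /dyadic_quotient (Fu xu') subr0 normrM gtr0_norm ?invr_gt0//.
  rewrite ler_wpM2l ?invr_ge0 ?(ltW q0)//.
  rewrite lerBlDr lerBrDr.
  have [ux|xu2] := leP u (x + 2 ^ n); last by rewrite Fu ?normr0 ?(ltW xu2).
  have [xv|vx] := leP (x + 2 ^ n) v; first exact: lipschitz_support_le1.
  by rewrite Fv ?normr0 ?(ltW vx).
rewrite ge0_integralZl_EFin ?invr_ge0 ?(ltW q0)//; last first.
  by apply/measurable_EFinP; exact: measurable_indic.
rewrite integral_indic_itvcc ?lerD2r ?(ltW uv)//.
by rewrite -EFinM lee_fin mulrC opprB addrA subrK /L.
Qed.

(** * The variation of a single atom in L^1 *)

Variable s : R.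
Hypothesis s2 : 2 <= s.

Let V x : \bar R :=
  'N[counting]_s%:E[EFin \o (fun k => dyadic_increment (int_of_nat k) x)]%E.

(* On the middle interval, AM-GM: [sqrt S <= (L * S + 1 / L) / 2]. *)
Lemma dyadic_variation_le x : (V x <=
  (L / 2)%:E * (\sum_(k <oo) (dyadic_increment (int_of_nat k) x ^+ 2)%:E)
  + (L^-1 / 2)%:E * (\1_(`[u - L, v]%classic) x)%:E
  + \sum_(k <oo) (far (int_of_nat k) x + far (int_of_nat k - 1) x)%:E)%E.
Proof.
have s1 : 1 <= s by apply: le_trans s2; rewrite ler1n.
have s0 : 0 < s by apply: lt_le_trans s1.
set S := (\sum_(k <oo) _)%E; set T := (\sum_(k <oo) (_ + _)%:E)%E.
have S0 : (0 <= S)%E by apply: nneseries_ge0 => k _ _; rewrite lee_fin sqr_ge0.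
have T0 : (0 <= T)%E by apply: nneseries_ge0 => k _ _; rewrite lee_fin addr_ge0.
have i0 : (0 <= (L^-1 / 2)%:E * (\1_(`[u - L, v]%classic) x)%:E)%E.
  by rewrite -EFinM lee_fin mulr_ge0// ?indicE// divr_ge0 ?invr_ge0 ?ltW.
have LS0 : (0 <= (L / 2)%:E * S)%E by rewrite mule_ge0// lee_fin divr_ge0 ?ltW.
(* On the far left the l^s norm is replaced by the larger l^1 norm, and each increment by the sum of
   two neighbouring quotients in absolute value. *)
have [xu|ux] := ltP x (u - L).
  apply: (@le_trans _ _ T); last by rewrite leeDr// adde_ge0.
  apply: (le_trans (@le_Lnorm_counting _ 1 s _ _ s1)) => //.
  rewrite Lnorm_counting// invr1 poweRe1; last first.
    by apply: nneseries_ge0 => k _ _; exact: poweR_ge0.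
  apply: lee_nneseries => [k _ _|k _]; first exact: poweR_ge0.
  rewrite poweRe1 ?abse_ge0//= lee_fin /far !indicE !mem_setE !in_itv/= xu !mul1r.
  exact: ler_normB.
have [xv|vx] := leP x v; last first.
  rewrite /V (_ : _ \o _ = cst 0%E) ?Lnorm0 ?eqe ?gt_eqF//.
    by rewrite !adde_ge0.
  apply/funext => k /=.
  by rewrite /dyadic_increment !dyadic_quotient_outside ?subrr//; right.
rewrite (le_trans _ (leeDl _ T0))// indicE mem_setE in_itv/= ux xv/= mule1.
(* Here [2 <= s] enters: the variation is dominated by the square function. *)
apply: (le_trans (@le_Lnorm_counting _ 2 s _ _ s2)) => //.
rewrite Lnorm_counting//.
have -> : (\sum_(k <oo)
    `|(EFin \o (fun k => dyadic_increment (int_of_nat k) x)) k| `^ 2 = S)%E.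
  apply: eq_eseriesr => k _ /=.
  by rewrite -[X in (_ `^ X)%R]/(2%:R) powR_mulrn// real_normK ?num_real.
move: S0; case: (S) => [r||]//; last first.
  by rewrite gt0_muley ?lte_fin ?divr_gt0// addye ?leey.
rewrite lee_fin => r0.
rewrite poweR12_sqrt; last by rewrite lee_fin.
rewrite -EFinM -EFinD lee_fin /=.
rewrite -{2}(sqr_sqrtr r0); move: (Num.sqrt r) => t.
have /mulfV : L != 0 by exact: lt0r_neq0.
have : 0 < L^-1 by rewrite invr_gt0.
move: L L0 (L^-1) => l l0 k k0 lk.
(* Since [l * k = 1], this square expands to [l * t ^ 2 - 2 * t + k >= 0], which is the required
   inequality for [t]. *)
have : 0 <= k * (l * t - 1) ^+ 2 by rewrite mulr_ge0 ?sqr_ge0// ltW.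
have -> : k * (l * t - 1) ^+ 2 = (l * k) * l * t ^+ 2 - 2 * (l * k) * t + k by rewrite !expr2; lra.
by rewrite lk; lra.
Qed.

Let mD2 n : measurable_fun [set: R] (fun x => (dyadic_increment n x ^+ 2)%:E).
Proof. exact: (msq (measurable_dyadic_increment n)). Qed.

(** The constant is 4 + 1 + 4: the square function gives [(L / 2) * (8 / L)], the indicator of an
    interval of length [2 * L] gives 1, and the far part gives 4. *)
Lemma integral_dyadic_variation : (\int[mu]_x V x <= 9%:E)%E.
Proof.
have k0 : 0 <= L / 2 by rewrite divr_ge0// ltW.
have k1 : 0 <= L^-1 / 2 by rewrite divr_ge0// invr_ge0 ltW.
have mS : measurable_fun [set: R]
    (fun x => \sum_(k <oo) (dyadic_increment (int_of_nat k) x ^+ 2)%:E)%E.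
  apply: ge0_emeasurable_sum => [k x _ _|k _]; first by rewrite lee_fin sqr_ge0.
  exact: mD2.
have S0 x : (0 <= \sum_(k <oo) (dyadic_increment (int_of_nat k) x ^+ 2)%:E)%E.
  by apply: nneseries_ge0 => k _ _; rewrite lee_fin sqr_ge0.
have mI : measurable_fun [set: R] (fun x => (\1_(`[u - L, v]%classic) x)%:E : \bar R).
  by apply/measurable_EFinP; exact: measurable_indic.
have mff n : measurable_fun [set: R] (fun x => (far n x + far (n - 1) x)%:E).
  under eq_fun do rewrite EFinD.
  by apply: emeasurable_funD; exact: mfar.
have mT : measurable_fun [set: R]
    (fun x => \sum_(k <oo) (far (int_of_nat k) x + far (int_of_nat k - 1) x)%:E)%E.
  apply: ge0_emeasurable_sum => [k x _ _|k _]; first by rewrite lee_fin addr_ge0.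
  exact: mff.
have mV : measurable_fun [set: R] V.
  apply: measurable_Lnorm_counting => [|k]; first exact: lt_le_trans s2.
  exact: measurable_dyadic_increment.
have I0 (x : R) : (0 <= (\1_(`[u - L, v]%classic) x)%:E :> \bar R)%E.
  by rewrite lee_fin indicE.
have V0 x : [set: R] x -> (0 <= V x)%E by move=> _; exact: Lnorm_ge0.
apply: le_trans.
  apply: (@ge0_le_integral _ _ _ mu _ measurableT _ _ V0 mV _
    (fun x _ => dyadic_variation_le x)).
  by apply: emeasurable_funD => //; apply: emeasurable_funD; exact: measurable_funeM.
rewrite ge0_integralD//; last 3 first.
- by move=> x _; rewrite adde_ge0 ?mule_ge0.
- by apply: emeasurable_funD; exact: measurable_funeM.
- by move=> x _; apply: nneseries_ge0 => k _ _; rewrite lee_fin addr_ge0.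
rewrite ge0_integralD//; last 4 first.
- by move=> x _; rewrite mule_ge0.
- exact: measurable_funeM.
- by move=> x _; rewrite mule_ge0.
- exact: measurable_funeM.
rewrite !ge0_integralZl_EFin//.
rewrite integral_indic_itvcc; last by move: L0 uv; lra.
rewrite integral_nneseries//; last 2 first.
- by move=> k; exact: mff.
- by move=> k x _; rewrite lee_fin addr_ge0.
rewrite integral_nneseries//; last 2 first.
- by move=> k; exact: mD2.
- by move=> k x _; rewrite lee_fin sqr_ge0.
have ff0 n x : [set: R] x -> (0 <= (EFin \o far n) x)%E by rewrite lee_fin.
have h1 : (\sum_(k <oo) \int[mu]_x (dyadic_increment (int_of_nat k) x ^+ 2)%:E
    <= (8 / L)%:E)%E.
  apply: (@nneseries_int_telescope _
    (fun n => \int[mu]_x (dyadic_increment n x ^+ 2)%:E)%E energy).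
  - by move=> n; apply: integral_ge0 => x _; rewrite lee_fin sqr_ge0.
  - exact: energy_ge0.
  - exact: energy_le.
  - by move=> n; rewrite energy_increment.
(* Both [far n] and [far (n - 1)] telescope, against [c n] and [c (n - 1)], each of which is at most
   2. *)
have h2 : (\sum_(k <oo)
    \int[mu]_x (far (int_of_nat k) x + far (int_of_nat k - 1) x)%:E <= 4%:E)%E.
  apply: (@nneseries_int_telescope _
    (fun n => \int[mu]_x (far n x + far (n - 1) x)%:E)%E
    (fun n => c n + c (n - 1))%E).
  - by move=> n; apply: integral_ge0 => x _; rewrite lee_fin addr_ge0.
  - by move=> n; rewrite adde_ge0.
  - move=> n; rewrite -EFinD lee_fin (_ : 4 = 2 + 2) ?lerD ?ge_min ?lexx ?orbT//; lra.
  - move=> n; apply: (@le_trans _ _ ((b n + b (n - 1)) + (c n + c (n - 1)))%E).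
      rewrite leeD2r//; under eq_integral do rewrite EFinD.
      rewrite (ge0_integralD mu measurableT (@ff0 n) (mfar n) (@ff0 (n - 1)) (mfar _)).
      by apply: leeD; exact: integral_far.
    rewrite addeACA; apply: leeD; exact: bc.
apply: (le_trans (leeD (leeD (lee_wpmul2l _ h1) (lexx _)) h2)); first by rewrite lee_fin.
rewrite -!EFinM -!EFinD lee_fin.
have /mulfV : L != 0 by exact: lt0r_neq0.
have -> : v - (u - L) = L + L by rewrite /L; lra.
move: L (L^-1) => l k lk.
have -> : l / 2 * (8 * k) + k / 2 * (l + l) + 4 = 5 * (l * k) + 4 by lra.
by rewrite lk; lra.
Qed.

End dyadic_quotient.

(** * The variation operator on atoms and on atomic sums *)

Section variation.
Context {R : realType}.
Local Notation mu := (@lebesgue_measure R).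
Implicit Types (f : R -> R) (s : R).

Lemma variation_operatorE s f x : 0 < s -> mu.-integrable [set: R] (EFin \o f) ->
  variation_operator s f x = 'N[counting]_s%:E[EFin \o
    (fun k => dyadic_increment (primitive f) (int_of_nat k) x)]%E.
Proof.
move=> s0 intf; rewrite Lnorm_counting// /variation_operator esum_int; last first.
  by move=> n; rewrite lee_fin powR_ge0.
congr (_ `^ _)%E; apply: eq_eseriesr => k _.
by rewrite /= !forward_averageE.
Qed.

Lemma measurable_variation s f : 0 < s -> mu.-integrable [set: R] (EFin \o f) ->
  measurable_fun [set: R] (variation_operator s f).
Proof.
move=> s0 intf.
have -> : variation_operator s f = (fun x => 'N[counting]_s%:E[EFin \o
    (fun k => dyadic_increment (primitive f) (int_of_nat k) x)]%E).
  by apply/funext => x; exact: variation_operatorE.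
apply: measurable_Lnorm_counting => // k.
exact: (measurable_dyadic_increment (measurable_primitive intf)).
Qed.

Lemma variation_ge0 s f x : (0 <= variation_operator s f x)%E.
Proof. by rewrite /variation_operator poweR_ge0. Qed.

Lemma integral_variation_atom s f : 2 <= s -> atom f ->
  (\int[mu]_x variation_operator s f x <= 9%:E)%E.
Proof.
move=> s2 /atom_primitive[u [v [uv intf Fu Fv lip]]].
have s0 : 0 < s by apply: lt_le_trans s2.
under eq_integral do rewrite variation_operatorE//.
exact: (integral_dyadic_variation uv (measurable_primitive intf) Fu Fv lip s2).
Qed.

Lemma variation_decomposition s f c a x : 1 <= s ->
  mu.-integrable [set: R] (EFin \o f) -> atomic_decomposition f c a ->
  (variation_operator s f x <=
   \sum_(j <oo) `|c j|%:E * variation_operator s (a j) x)%E.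
Proof.
move=> s1 intf [ata _ cvgf]; have s0 : 0 < s by apply: lt_le_trans s1.
have inta j : mu.-integrable [set: R] (EFin \o a j).
  by have [u [v []]] := atom_primitive (ata j).
pose fN N y := \sum_(j < N) c j * a j y.
have intfN N : mu.-integrable [set: R] (EFin \o fN N) by have [] := primitive_sum c N 0 inta.
have t0 j : (0 <= `|c j|%:E * variation_operator s (a j) x)%E.
  by rewrite mule_ge0// variation_ge0.
rewrite variation_operatorE//.
apply: (@Lnorm_counting_lsc _ s
    (fun N k => dyadic_increment (primitive (fN N)) (int_of_nat k) x)) => //.
- by apply: nneseries_ge0 => j _ _; exact: t0.
(* An increment at [x] is a finite combination of values of the primitive, so pointwise convergence
   of the primitives suffices. *)
- move=> k.
  have prim y : primitive (fN N) y @[N --> \oo] --> primitive f y.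
    have h : `|primitive (fN N) y - primitive f y|%:E @[N --> \oo] --> 0%:E.
      apply: squeeze_cvge (cvg_cst 0%E) cvgf.
      apply: nearW => N; rewrite lee_fin normr_ge0/= distrC.
      exact: primitive_dist.
    have h1 := fine_cvg h.
    by apply/subr_cvg0; apply: norm_cvg0; exact: h1.
  have quot n : dyadic_quotient (primitive (fN N)) n x @[N --> \oo] -->
      dyadic_quotient (primitive f) n x.
    by apply: cvgMr; apply: cvgB; exact: prim.
  by apply: cvgB; exact: quot.
- move=> N.
  have -> : (fun k => dyadic_increment (primitive (fN N)) (int_of_nat k) x) =
    (fun k => \sum_(j < N) c j * dyadic_increment (primitive (a j)) (int_of_nat k) x).
    have pE y : primitive (fN N) y = \sum_(j < N) c j * primitive (a j) y.
      by have [] := primitive_sum c N y inta.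
    have qE n : dyadic_quotient (primitive (fN N)) n x =
        \sum_(j < N) c j * dyadic_quotient (primitive (a j)) n x.
      rewrite /dyadic_quotient !pE -sumrB mulr_sumr.
      by apply: eq_bigr => j _; rewrite -mulrBr mulrCA.
    apply/funext => k; rewrite /dyadic_increment !qE -sumrB.
    by apply: eq_bigr => j _; rewrite mulrBr.
  apply: le_trans (Lnorm_counting_sum (fun j k =>
    dyadic_increment (primitive (a j)) (int_of_nat k) x) c N s1) _.
  rewrite -(big_mkord xpredT (fun j => (`|c j|%:E * 'N[counting]_s%:E[EFin \o
    (fun k => dyadic_increment (primitive (a j)) (int_of_nat k) x)])%E)).
  under eq_bigr do rewrite -variation_operatorE//.
  by apply: nneseries_lim_ge => j _ _; exact: t0.
Qed.

(** The pointwise bound is integrated term by term, each atom costing at most 9. The decomposition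
    is arbitrary, so that the infimum can be taken afterwards. *)
Lemma integral_variation s f c a : 2 <= s ->
  mu.-integrable [set: R] (EFin \o f) -> atomic_decomposition f c a ->
  (\int[mu]_x variation_operator s f x <= 9%:E * \sum_(0 <= j <oo) `|c j|%:E)%E.
Proof.
move=> s2 intf dec; have [ata _ _] := dec.
have s1 : 1 <= s by apply: le_trans s2; rewrite ler1n.
have s0 : 0 < s by apply: lt_le_trans s1.
have inta j : mu.-integrable [set: R] (EFin \o a j).
  by have [u [v []]] := atom_primitive (ata j).
have t0 j x : (0 <= `|c j|%:E * variation_operator s (a j) x)%E.
  by rewrite mule_ge0// variation_ge0.
have mt j : measurable_fun [set: R] (fun x => `|c j|%:E * variation_operator s (a j) x)%E.
  by apply: measurable_funeM; exact: measurable_variation.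
have V0 x : [set: R] x -> (0 <= variation_operator s f x)%E.
  by move=> _; exact: variation_ge0.
apply: le_trans.
  apply: (@ge0_le_integral _ _ _ mu _ measurableT _ _ V0 (measurable_variation s0 intf) _
    (fun x _ => variation_decomposition x s1 intf dec)).
  by apply: ge0_emeasurable_sum => [j x _ _|j _]; [exact: t0|exact: mt].
rewrite integral_nneseries// -nneseriesZl//.
apply: lee_nneseries => [j _ _|j _]; first exact: integral_ge0.
rewrite (ge0_integralZl_EFin mu measurableT (fun x _ => variation_ge0 s (a j) x)
  (measurable_variation s0 (inta j)) (normr_ge0 _)).
rewrite [leRHS]muleC; apply: lee_wpmul2l => //.
exact: integral_variation_atom.
Qed.

End variation.

Unset Implicit Arguments.

Theorem theorem1 (R : realType) (s : R) (hs : 2 <= s) :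
  exists C : R, 0 < C /\
    forall f : R -> R, hardy1 f ->
      lebesgue_measure.-integrable [set: R] (variation_operator s f) /\
      ('N[lebesgue_measure]_1[variation_operator s f] <= C%:E * hardy1_norm f)%E.
Proof.
(* The constant is the bound for a single atom. *)
exists 9; split => // f [intf [c [a dec]]].
have s0 : 0 < s by apply: lt_le_trans hs.
have absV : (fun x => `|variation_operator s f x|)%E = variation_operator s f.
  by apply/funext => x; rewrite gee0_abs// variation_ge0.
split.
  apply/integrableP; split; first exact: measurable_variation.
  under eq_integral do rewrite gee0_abs ?variation_ge0//.
  apply: le_lt_trans (integral_variation hs intf dec) _.
  by have [_ csum _] := dec; rewrite lte_mul_pinfty// lee_fin.
rewrite Lnorm1; under eq_integral do rewrite gee0_abs ?variation_ge0//.
(* With the factor 9 moved to the left, it remains to bound the coefficient sum of every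
   decomposition from below. *)
rewrite -lee_pdivrMl//; apply/ereal_infP => _ [c' [a' [dec' ->]]].
by rewrite lee_pdivrMl//; exact: integral_variation dec'.
Qed.
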